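(* Assume $\eta=\frac{1-\kappa}{1-\theta}\ge1$ and $N>N_{\min}:=\frac{B+\sqrt{4AF_a}}{A}$. Then $$SC^{MC*}<SC_2^{AC*}<SC^{m*}<SC_0^{AC*}.$$
   Context: A continuum of commuters of mass $N>0$ splits between normal vehicles (NV, mass $N_n$) and shared autonomous vehicles (SAV, mass $N_a$), $N_n+N_a=N$, all passing a bottleneck of capacity $\mu>0$. Parameters: free-flow time $t_f\ge 0$; NV fixed cost $F_n\ge 0$; SAV waiting cost $w\ge 0$; SAV marginal operating cost $m\ge 0$; SAV fixed operating cost $F_a>0$; $\beta,\gamma>0$; $\theta$ with $\beta<\theta<1$; $0<\kappa<1$. Given the split and the SAV fare $p$, the mode-specific commuting costs (in departure-time equilibrium) are $$c_n^*=\frac{\beta\gamma}{\mu(\beta+\gamma)}(N_n+\kappa N_a)+t_f+F_n,\qquad c_a^*=\frac{\beta\gamma}{\mu(\beta+\gamma)}(\theta N_n+\kappa N_a)+\theta t_f+p+w .$$ Set $A=\frac{\beta\gamma(1-\theta)}{(\beta+\gamma)\mu}$, $B=\theta t_f+m+w-(t_f+F_n)$. Standing assumptions: $0<B<AN$, and $N>N_{\min}$ (so that SAVs are used under average cost and monopoly pricing). The social cost of an equilibrium is $N_nc_n^*+N_ac_a^*-\pi$ with provider profit $\pi=(p-m)N_a-F_a$; if $N_a=0$ it is $N\,c_n^*(N,0)+F_a$ (so $\pi=-F_a$). Equilibria considered: $SC^{MC*}$: marginal cost pricing $p=m$, $N_a=\frac{AN-B}{A}$. $SC_0^{AC*}$: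 average cost pricing, zero-adoption equilibrium $N_a=0$. $SC_2^{AC*}$: average cost pricing $p=m+F_a/N_a$, high-adoption equilibrium $N_a=\frac{AN-B+\sqrt{(AN-B)^2-4AF_a}}{2A}$. $SC^{m*}$: unregulated monopoly pricing $p=m+\frac{AN-B}{2}$, $N_a=\frac{AN-B}{2A}$. *)

(* Defs.v *)
From Stdlib Require Export Reals.
Open Scope R_scope.

Record model := Model {
  mass : R;        (* N, total mass of commuters *)
  capacity : R;    (* mu *)
  t_f : R;         (* free-flow travel time *)
  F_n : R;         (* fixed cost of a normal vehicle (NV) *)
  wait : R;        (* w, waiting cost of a shared autonomous vehicle (SAV) *)
  marg : R;        (* m, marginal operating cost of SAVs *)
  F_a : R;         (* fixed operating cost of SAVs *)
  beta : R;
  gamma : R;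
  theta : R;
  kappa : R
}.

Section Costs.
Variable M : model.

Definition delta : R :=
  beta M * gamma M / (capacity M * (beta M + gamma M)).

(* Commuting costs in the departure-time equilibrium, given the modal split
   [Nn], [Na] and the SAV fare [p]. *)
Definition c_n (Nn Na : R) : R :=
  delta * (Nn + kappa M * Na) + t_f M + F_n M.

Definition c_a (Nn Na p : R) : R :=
  delta * (theta M * Nn + kappa M * Na) + theta M * t_f M + p + wait M.

Definition profit (Na p : R) : R := (p - marg M) * Na - F_a M.

Definition social_cost (Na p : R) : R :=
  let Nn := mass M - Na in
  Nn * c_n Nn Na + Na * c_a Nn Na p - profit Na p.

Definition coefA : R :=
  beta M * gamma M * (1 - theta M) / ((beta M + gamma M) * capacity M).

Definition coefB : R :=
  theta M * t_f M + marg M + wait M - (t_f M + F_n M).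

Definition eta : R := (1 - kappa M) / (1 - theta M).

Definition N_min : R := (coefB + sqrt (4 * coefA * F_a M)) / coefA.

(* In the suffixes below, MC stands for marginal cost pricing, AC0 and AC2 for
   average cost pricing with zero and high adoption, and mono for unregulated
   monopoly pricing. *)
Definition Na_MC : R := (coefA * mass M - coefB) / coefA.
Definition p_MC : R := marg M.
Definition SC_MC : R := social_cost Na_MC p_MC.

Definition Na_AC2 : R :=
  (coefA * mass M - coefB
   + sqrt ((coefA * mass M - coefB) ^ 2 - 4 * coefA * F_a M)) / (2 * coefA).
Definition p_AC2 : R := marg M + F_a M / Na_AC2.
Definition SC_AC2 : R := social_cost Na_AC2 p_AC2.

(* The average-cost fare is undefined at zero adoption, where the provider's
   profit is [- F_a]; this agrees with [social_cost 0 p] for every [p]. *)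
Definition SC_AC0 : R := mass M * c_n (mass M) 0 + F_a M.

Definition Na_mono : R := (coefA * mass M - coefB) / (2 * coefA).
Definition p_mono : R := marg M + (coefA * mass M - coefB) / 2.
Definition SC_mono : R := social_cost Na_mono p_mono.

End Costs.

(* Main.v *)
Require Import Defs.
From Stdlib Require Import Reals.
From Stdlib Require Import Lra.
Open Scope R_scope.

(** The fare is a transfer from SAV users to the provider, so the social cost
    depends on the SAV adoption [x] alone.  It is the quadratic
    [A x^2 - ((1 + eta) A N - B) x] up to a constant, where
    [A eta = delta (1 - kappa)].  Its minimiser is [((1 + eta) A N - B) / (2 A)];
    when [eta >= 1] this is at least [N - B / (2 A)], hence beyond the adoption
    [N - B / A] under marginal cost pricing.  The social cost therefore strictly
    decreases on [[0, N - B / A]] ([social_cost_decreasing]), and the four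
    equilibria are ranked by their adoptions,
    [0 < Na_mono < Na_AC2 < Na_MC].  The last two inequalities hold because
    [N > N_min] makes the discriminant in [Na_AC2] positive while [F_a > 0]
    makes its square root smaller than [A N - B]. *)

Lemma coefA_delta (M : model) :
  capacity M <> 0 -> beta M + gamma M <> 0 ->
  coefA M = delta M * (1 - theta M).
Proof. intros hmu hbg; unfold coefA, delta; field; auto. Qed.

(** Neither fare occurs on the right-hand side. *)
Lemma social_cost_diff (M : model) (x y p q : R) :
  coefA M = delta M * (1 - theta M) ->
  social_cost M y q - social_cost M x p
  = (y - x) * (coefA M * (x + y)
               - (coefA M + delta M * (1 - kappa M)) * mass M + coefB M).
Proof.
intros ->; unfold social_cost, profit, c_n, c_a, coefB; ring.
Qed.

(** The hypothesis [coefA M <= delta M * (1 - kappa M)] is [1 <= eta M] cleared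
    of its denominator. *)
Lemma social_cost_decreasing (M : model) (x y p q : R) :
  coefA M = delta M * (1 - theta M) ->
  0 < coefA M -> 0 < mass M -> 0 < coefB M ->
  coefA M <= delta M * (1 - kappa M) ->
  x < y -> y <= Na_MC M ->
  social_cost M y q < social_cost M x p.
Proof.
intros hAd hA hN hB heta hxy hy.
assert (hAy : coefA M * y <= coefA M * mass M - coefB M).
{ replace (coefA M * mass M - coefB M) with (coefA M * Na_MC M)
    by (unfold Na_MC; field; lra).
  apply Rmult_le_compat_l; lra. }
assert (hAx : coefA M * x < coefA M * y) by (apply Rmult_lt_compat_l; lra).
assert (hAN : coefA M * mass M <= delta M * (1 - kappa M) * mass M)
  by (apply Rmult_le_compat_r; lra).
pose proof (social_cost_diff M x y p q hAd) as hdiff.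
assert (hslope : coefA M * (x + y)
  - (coefA M + delta M * (1 - kappa M)) * mass M + coefB M < 0) by lra.
nra.
Qed.

Lemma discriminant_gt0 (M : model) :
  0 < coefA M -> 0 < F_a M -> N_min M < mass M ->
  0 < (coefA M * mass M - coefB M) ^ 2 - 4 * coefA M * F_a M.
Proof.
intros hA hFa hNmin.
assert (hAF : 0 < 4 * coefA M * F_a M) by nra.
assert (hlt : sqrt (4 * coefA M * F_a M) < coefA M * mass M - coefB M).
{ apply (Rmult_lt_compat_l (coefA M)) in hNmin; [|assumption].
  replace (coefA M * N_min M) with (coefB M + sqrt (4 * coefA M * F_a M))
    in hNmin by (unfold N_min; field; lra).
  lra. }
pose proof (sqrt_lt_R0 _ hAF) as hs0.
pose proof (sqrt_sqrt _ (Rlt_le _ _ hAF)) as hs.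
nra.
Qed.

Lemma Na_mono_lt_AC2 (M : model) :
  0 < coefA M ->
  0 < (coefA M * mass M - coefB M) ^ 2 - 4 * coefA M * F_a M ->
  Na_mono M < Na_AC2 M.
Proof.
intros hA hD; unfold Na_mono, Na_AC2, Rdiv.
apply Rmult_lt_compat_r; [apply Rinv_0_lt_compat; lra|].
pose proof (sqrt_lt_R0 _ hD); lra.
Qed.

Lemma Na_AC2_lt_MC (M : model) :
  0 < coefA M -> 0 < F_a M -> coefB M < coefA M * mass M ->
  0 < (coefA M * mass M - coefB M) ^ 2 - 4 * coefA M * F_a M ->
  Na_AC2 M < Na_MC M.
Proof.
intros hA hFa hBAN hD.
assert (hs : sqrt ((coefA M * mass M - coefB M) ^ 2 - 4 * coefA M * F_a M)
             < coefA M * mass M - coefB M).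
{ rewrite <- (sqrt_pow2 (coefA M * mass M - coefB M)) at 2 by lra.
  apply sqrt_lt_1; nra. }
replace (Na_MC M) with (2 * (coefA M * mass M - coefB M) / (2 * coefA M))
  by (unfold Na_MC; field; lra).
unfold Na_AC2, Rdiv.
apply Rmult_lt_compat_r; [apply Rinv_0_lt_compat|]; lra.
Qed.

Lemma SC_AC0_social_cost (M : model) (p : R) : SC_AC0 M = social_cost M 0 p.
Proof.
unfold SC_AC0, social_cost, profit; rewrite Rminus_0_r; ring.
Qed.

Theorem proposition8 (M : model)
  (hN : 0 < mass M) (hmu : 0 < capacity M)
  (htf : 0 <= t_f M) (hFn : 0 <= F_n M) (hw : 0 <= wait M) (hm : 0 <= marg M)
  (hFa : 0 < F_a M)
  (hbeta : 0 < beta M) (hgamma : 0 < gamma M)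
  (hbt : beta M < theta M) (htheta : theta M < 1)
  (hkappa0 : 0 < kappa M) (hkappa1 : kappa M < 1)
  (hB : 0 < coefB M) (hBAN : coefB M < coefA M * mass M)
  (heta : 1 <= eta M) (hNmin : N_min M < mass M) :
  SC_MC M < SC_AC2 M /\ SC_AC2 M < SC_mono M /\ SC_mono M < SC_AC0 M.
Proof.
assert (hAd : coefA M = delta M * (1 - theta M)) by (apply coefA_delta; lra).
assert (hd : 0 < delta M).
{ unfold delta; apply Rdiv_lt_0_compat; apply Rmult_lt_0_compat; lra. }
assert (hA : 0 < coefA M) by (rewrite hAd; apply Rmult_lt_0_compat; lra).
assert (hAeta : coefA M <= delta M * (1 - kappa M)).
{ replace (delta M * (1 - kappa M)) with (coefA M * eta M)
    by (rewrite hAd; unfold eta; field; lra).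
  nra. }
pose proof (discriminant_gt0 M hA hFa hNmin) as hD.
pose proof (Na_mono_lt_AC2 M hA hD) as hmono.
pose proof (Na_AC2_lt_MC M hA hFa hBAN hD) as hAC2.
assert (h0 : 0 < Na_mono M) by (unfold Na_mono; apply Rdiv_lt_0_compat; lra).
rewrite (SC_AC0_social_cost M 0).
unfold SC_MC, SC_AC2, SC_mono.
repeat split; apply social_cost_decreasing; lra.
Qed.
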